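(* Let $\mu$ be the measure on $\mathbb{R}$ with density $e^{-|\gamma|}/2$ for $\gamma\in\mathbb{R}$, and write $\Gamma(X)=\Gamma(X,\mu)$. (1) Let $X\subset\{0,1\}^n$ be a non-empty subset of the Boolean cube. Then $$\ln|X|\le(2\ln 2)\,\Gamma(X).$$ (2) Let $X\subset\{0,1\}^n$ be a non-empty subset of the Boolean cube such that $\xi_1+\cdots+\xi_n\le k$ for every $(\xi_1,\ldots,\xi_n)\in X$ (that is, $X$ lies in the Hamming ball of radius $k$). Then $$\ln|X|\le\Gamma(X)+k\ln 2.$$
   Context: $|X|$ is the cardinality of $X$. For a non-empty $X\subset\{0,1\}^n$, $$\Gamma(X,\mu)=\mathbf{E}\max_{x\in X}\langle c,x\rangle,$$ where $c=(\gamma_1,\ldots,\gamma_n)$ has independent coordinates with distribution $\mu$ and $\langle\cdot,\cdot\rangle$ is the standard scalar product in $\mathbb{R}^n$. *)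

(* Defs.v *)
From HB Require Import structures.
From mathcomp Require Import all_boot all_order all_algebra.
From mathcomp Require Import all_classical all_reals all_analysis.

Set Implicit Arguments.
Unset Strict Implicit.
Unset Printing Implicit Defensive.

Import Order.TTheory GRing.Theory Num.Theory.
Import numFieldNormedType.Exports.

Local Open Scope classical_set_scope.
Local Open Scope ring_scope.

Definition cube (n : nat) := {ffun 'I_n -> bool}.

Definition weight (n : nat) (x : cube n) : nat := (\sum_(i < n) x i)%N.

Definition cube_dot (R : realType) (n : nat) (c : 'I_n -> R) (x : cube n) : R :=
  \sum_(i < n) c i * (x i)%:R.

(* The maximum is taken in \bar R, where -oo is neutral; for non-empty X it is
   a real number (cube_max_attained, cube_max_ge), so [fine] loses nothing. *)
Definition cube_max (R : realType) (n : nat) (X : {set cube n})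
    (c : 'I_n -> R) : R :=
  fine (\big[maxe/-oo%E]_(x in X) (cube_dot c x)%:E).

Lemma cube_max_attained (R : realType) (n : nat) (X : {set cube n})
    (c : 'I_n -> R) : X != finset.set0 ->
  exists2 x, x \in X & cube_max X c = cube_dot c x.
Proof.
move=> /set0Pn[x0 x0X]; rewrite /cube_max.
have [|x xX ->] := @eq_bigmax _ _ _ -oo%E x0 (mem X)
  (fun x => (cube_dot c x)%:E) x0X.
  by move=> x _; rewrite leNye.
by exists x.
Qed.

Lemma cube_max_ge (R : realType) (n : nat) (X : {set cube n})
    (c : 'I_n -> R) (x : cube n) : x \in X -> cube_dot c x <= cube_max X c.
Proof.
move=> xX.
have X0 : X != finset.set0 by apply/set0Pn; exists x.
have := @le_bigmax_cond _ _ _ -oo%E x (mem X)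
  (fun x => (cube_dot c x)%:E) xX.
have /set0Pn[x0 x0X] := X0; rewrite /cube_max.
have [|y yX ->] := @eq_bigmax _ _ _ -oo%E x0 (mem X)
  (fun x => (cube_dot c x)%:E) x0X.
  by move=> y _; rewrite leNye.
by rewrite lee_fin.
Qed.

Definition mutually_independent (d : measure_display) (T : measurableType d)
    (R : realType) (P : probability T R) (n : nat)
    (c : 'I_n -> {RV P >-> R}) : Prop :=
  forall (J : {set 'I_n}) (A : 'I_n -> set R),
    (forall i, measurable (A i)) ->
    P (\bigcap_(i in [set` J]) (c i @^-1` A i)) =
      (\prod_(i in J) P (c i @^-1` A i))%E.

Definition has_law (d : measure_display) (T : measurableType d)
    (R : realType) (P : probability T R) (mu : set R -> \bar R)
    (Y : {RV P >-> R}) : Prop :=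
  forall A : set R, measurable A -> distribution P Y A = mu A.

Definition iid_with_law (d : measure_display) (T : measurableType d)
    (R : realType) (P : probability T R) (n : nat) (mu : set R -> \bar R)
    (c : 'I_n -> {RV P >-> R}) : Prop :=
  mutually_independent c /\ forall i, has_law mu (c i).

(* Gamma(X, mu), for c a realization of the random vector on the probability
   space P; it only depends on the law of c. *)
Definition Gamma (d : measure_display) (T : measurableType d)
    (R : realType) (P : probability T R) (n : nat)
    (c : 'I_n -> {RV P >-> R}) (X : {set cube n}) : \bar R :=
  'E_P[fun w => cube_max X (fun i => c i w)].

Definition double_exponential (R : realType) (A : set R) : \bar R :=
  (\int[lebesgue_measure]_(x in A) (expR (- `|x|) / 2)%:E)%E.

(* Main.v *)
Require Import Defs.
From mathcomp Require Import all_boot all_order all_algebra.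
From mathcomp Require Import all_classical all_reals all_analysis.
From mathcomp Require Import measurable_realfun ring lra.
Import Order.TTheory GRing.Theory Num.Theory.
Import numFieldNormedType.Exports.
Local Open Scope classical_set_scope.
Local Open Scope ring_scope.
Set Implicit Arguments.
Unset Strict Implicit.
Unset Printing Implicit Defensive.

(** The bound on [Gamma] comes from playing a strategy. Reveal the scores
c_1, ..., c_n one at a time, and after each one decide the corresponding
coordinate of a point of X by a threshold test: take the coordinate 1 exactly
when c_i > - t. The point x(c) chosen in this way lies in X, so the maximum of
<c, x> over X is at least <c, x(c)>, whatever the thresholds are.

If L0 and L1 are lower bounds for what the two slices x_i = 0 and x_i = 1
guarantee, the right threshold has t = L1 - L0. Together the slices then
guarantee
  L0 + P(c_i > - t) t + E[c_i; c_i > - t] = L0 + E max(c_i + t, 0),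
and for the law with density e^{-|x|} / 2 one has
  E max(c_i + t, 0) = max(t, 0) + e^{-|t|} / 2,
the function [laplace_gain]. The decisions already taken constrain the revealed
scores only through a product event B, so mutual independence tested on product
events suffices: c_i keeps its law conditionally on B. This
is the content of [Rintegral_gain], proved by integrating the tail of
max(c_i - s, 0) restricted to B.

Hence any function L that is at most 0 when all coordinates are decided and
satisfies L(X) <= L(X_0) + laplace_gain (L(X_1) - L(X_0)) at every decision is a
lower bound for Gamma(X) ([adaptive_choice_bound]). Both parts of the theorem
are instances.
- For L(X) = ln|X| / (2 ln 2) the inequality says that
  ln (1 + e^{-(2 ln 2) s}) <= (ln 2) e^{-s} for s >= 0 ([ln1D_expRN_le]);
  equality at s = 0 is what dictates the constant 2 ln 2.
- For L(X) = ln|X| - k ln 2, where k is the largest number of ones that a point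
  of X has among the undecided coordinates, deciding a coordinate to be 1 lowers
  k by at least one, so that the slice x_i = 1 counts for half of its cardinality. What is
  needed is e^u + e^v / 2 <= e^{u + laplace_gain (v - u)}
  ([expRD_half_le_gain]), which follows from e^x >= 1 + x. *)

(** * The gain function and its two inequalities *)

(** The expectation of max(g + t, 0) for a score g with density e^{-|x|} / 2. *)
Definition laplace_gain (R : realType) (t : R) : R :=
  Num.max t 0 + expR (- `|t|) / 2.

(** Concavity of ln, used for 1 / (1 + v) as a point of the segment [1/2, 1]:
both sides agree at v = 0 and v = 1. *)
Lemma ln1D_le_chord (R : realType) (v : R) : 0 <= v <= 1 ->
  (1 + v) * ln (1 + v) <= 2 * ln 2 * v.
Proof.
move=> /andP[v0 v1].
have w01 : 0 <= 2 * v / (1 + v) <= 1.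
  by rewrite ?divr_ge0 ?ler_pdivrMr/=; lra.
have [w0 w1] := andP w01.
have half_gt0 : 0 < 2^-1 :> R by rewrite invr_gt0.
have := concave_ln (Itv01 w0 w1) half_gt0 (ltr01 : 0 < 1 :> R).
rewrite ln1 !convRE /= mulr0 addr0 mulr1 lnV ?posrE//.
have -> : 2 * v / (1 + v) / 2 + unstable.onem (2 * v / (1 + v)) = (1 + v)^-1.
  by rewrite /unstable.onem; field; lra.
rewrite lnV ?posrE; last by lra.
rewrite mulrN lerN2 => h.
rewrite -ler_pdivlMl; last by lra.
by rewrite (le_trans h)// le_eqVlt; apply/orP; left; apply/eqP; field; lra.
Qed.

(** The function e^x ln (1 + e^{-ax}) is nonincreasing for x >= 0, because the sign
of its derivative is governed by [ln1D_le_chord] at v = e^{-ax}; at x = 0 it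
equals ln 2. *)
Lemma ln1D_expRN_le (R : realType) (s : R) : 0 <= s ->
  ln (1 + expR (- (2 * ln 2 * s))) <= ln 2 * expR (- s).
Proof.
set a := 2 * ln 2; move=> s0.
have a0 : 0 <= a by rewrite mulr_ge0// ln_ge0// ler1n.
pose phi := fun x : R => expR x * ln (1 + expR (- (a * x))).
have gt0 x : 0 < 1 + expR (- (a * x)) by rewrite addr_gt0 ?expR_gt0.
have dphi x : is_derive x (1:R) phi
  (expR x * (ln (1 + expR (- (a * x))) - a * expR (- (a * x)) / (1 + expR (- (a * x))))).
  have D1 : is_derive x (1:R) (fun x => 1 + expR (- (a * x))) (- (a * expR (- (a * x)))).
    apply: is_derive_eq.
    rewrite /GRing.scale/=. ring.
  have D2 := is_derive1_ln (gt0 x).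
  have D3 := @is_derive1_comp _ (@ln R) (fun x => 1 + expR (- (a * x))) _ _ _ D2 D1.
  have -> : phi = (@expR R : R -> R^o) * ((@ln R) \o (fun x => 1 + expR (- (a * x)))) by [].
  apply: is_derive_eq.
  rewrite /GRing.scale/=. ring.
have phi_le : phi s <= phi 0.
  apply: (@ler0_derive1_nincry _ phi 0) => //.
  - move=> x; rewrite in_itv/= andbT => x0.
    rewrite derive1E (@derive_val _ _ _ _ _ _ _ (dphi x)) mulr_ge0_le0 ?expR_ge0// subr_le0.
    rewrite ler_pdivlMr// mulrC; apply: ln1D_le_chord.
    by rewrite expR_ge0/= -expR0 ler_expR oppr_le0 mulr_ge0// ltW.
  - by apply: derivable_within_continuous => x _; case: (dphi x).
move: phi_le; rewrite /phi mulr0 oppr0 !expR0 mul1r -ler_pdivlMl ?expR_gt0// => h.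
by rewrite (le_trans h)// expRN mulrC.
Qed.

Lemma expRD_le_gain (R : realType) (u v : R) :
  expR (2 * ln 2 * u) + expR (2 * ln 2 * v) <=
  expR (2 * ln 2 * (u + laplace_gain (v - u))).
Proof.
set a := 2 * ln 2.
wlog uv : u v / u <= v.
  move=> H; have [/H//|/ltW vu] := leP u v.
  rewrite addrC (le_trans (H _ _ vu))// le_eqVlt; apply/orP; left; apply/eqP.
  congr (expR (_ * _)); rewrite /laplace_gain distrC !addrA; congr (_ + _).
  by rewrite (max_l (_ : 0 <= u - v)) ?(max_r (_ : v - u <= 0)); lra.
rewrite /laplace_gain ger0_norm ?max_l; [|by lra..].
have -> : expR (a * u) = expR (a * v) * expR (- (a * (v - u))).
  by rewrite -expRD; congr expR; ring.
rewrite -{2}[expR (a * v)]mulr1 -mulrDr.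
have -> : a * (u + (v - u + expR (- (v - u)) / 2)) = a * v + ln 2 * expR (- (v - u)).
  by rewrite /a; field.
rewrite expRD ler_pM2l ?expR_gt0// addrC -[leLHS]lnK; last first.
  by rewrite posrE addr_gt0 ?expR_gt0.
by rewrite ler_expR ln1D_expRN_le// subr_ge0.
Qed.

(** After division by the larger of e^u and e^v, one application of
e^x >= 1 + x. *)
Lemma expRD_half_le_gain (R : realType) (u v : R) :
  expR u + expR v / 2 <= expR (u + laplace_gain (v - u)).
Proof.
have -> : expR v = expR u * expR (v - u) by rewrite -expRD; congr expR; ring.
set t := v - u.
rewrite expRD -mulrA -{1}[expR u]mulr1 -mulrDr ler_pM2l ?expR_gt0//.
rewrite /laplace_gain.
have [t0|/ltW t0] := leP t 0.
  by rewrite add0r ler0_norm// opprK; exact: expR_ge1Dx.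
rewrite ger0_norm// expRD.
have -> : 1 + expR t / 2 = expR t * (expR (- t) + 2^-1).
  by rewrite mulrDr -expRD subrr expR0.
rewrite ler_pM2l ?expR_gt0//; apply: le_trans (expR_ge1Dx _).
have : expR (- t) <= 1 by rewrite -expR0 ler_expR oppr_le0.
lra.
Qed.

(** * Tails of the two-sided exponential law *)

Lemma integral_expRN_itvcy (R : realType) (a : R) :
  (\int[lebesgue_measure]_(x in `[a, +oo[) (expR (- x))%:E = (expR (- a))%:E)%E.
Proof.
have cF : continuous (fun x : R => - expR (- x)).
  move=> x; apply: cvgN; apply: continuous_comp; last exact: continuous_expR.
  exact: (@continuousN _ R^o).
rewrite (@ge0_continuous_FTC2y _ _ (fun x : R => - expR (- x)) _ 0)//.
- by rewrite sub0e EFinN oppeK.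
- apply: continuous_subspaceT => x.
  by apply: continuous_comp; [exact: (@continuousN _ R^o)|exact: continuous_expR].
- by rewrite -[X in _ --> X]oppr0; apply: cvgN; exact: cvgr_expR.
- by apply: cvg_at_right_filter; exact: cF.
- move=> x _; rewrite derive1E derive_val.
  by rewrite /GRing.scale/= mulrN1 opprK.
Qed.

Lemma measurable_laplace_pdf (R : realType) (D : set R) :
  measurable_fun D (fun x : R => expR (- `|x|) / 2).
Proof.
apply: measurable_funTS; apply: measurable_funM => //.
apply: measurableT_comp => //; apply: measurableT_comp => //.
Qed.

Lemma double_exponential_itvoy (R : realType) (r : R) : 0 <= r ->
  double_exponential `]r, +oo[%classic = (expR (- r) / 2)%:E.
Proof.
move=> r0; rewrite /double_exponential integral_itv_obnd_cbnd; last first.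
  by apply/measurable_EFinP; exact: measurable_laplace_pdf.
under eq_integral.
  move=> x; rewrite inE/= in_itv/= andbT => rx.
  rewrite ger0_norm ?(le_trans r0)// mulrC EFinM.
  over.
rewrite ge0_integralZl//=; last first.
  apply/measurable_EFinP/measurable_funTS.
  exact: measurableT_comp.
by rewrite integral_expRN_itvcy -EFinM mulrC.
Qed.

Lemma double_exponential_itvNyo (R : realType) (r : R) : 0 <= r ->
  double_exponential `]-oo, (- r)%R[%classic = (expR (- r) / 2)%:E.
Proof.
move=> r0; rewrite /double_exponential integral_itv_bndo_bndc; last first.
  by apply/measurable_EFinP; exact: measurable_laplace_pdf.
rewrite ge0_integration_by_substitutionNy; last 2 first.
- apply: continuous_subspaceT => x.
  apply: (@continuousM _ R^o (fun x => expR (- `|x|)) (fun=> 2^-1)); last exact: cst_continuous.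
  apply: continuous_comp; last exact: continuous_expR.
  apply: continuous_comp; last exact: (@continuousN _ R^o).
  exact: norm_continuous.
- by move=> x _; rewrite divr_ge0 ?expR_ge0.
rewrite -double_exponential_itvoy// /double_exponential integral_itv_obnd_cbnd; last first.
  by apply/measurable_EFinP; exact: measurable_laplace_pdf.
by apply: eq_integral => x _ /=; rewrite normrN.
Qed.

Section exponential_tail.
Context d (T : measurableType d) (R : realType) (P : probability T R).
Variables (B : set T) (Y : T -> R).
Hypotheses (mB : measurable B) (mY : measurable_fun setT Y).
Hypothesis tailY : forall r, 0 <= r ->
  P (B `&` [set w | r < Y w]) = (fine (P B) * (expR (- r) / 2))%:E.

(** The layer-cake formula for max(Y - s, 0) restricted to B. The event B is
kept throughout, since the threshold tests have to be integrated over the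
outcome of the earlier ones. *)
Lemma integral_excess (s : R) : 0 <= s ->
  (\int[P]_(w in B) (Num.max (Y w - s) 0)%:E = (fine (P B) * (expR (- s) / 2))%:E)%E.
Proof.
move=> s0.
pose Z := fun w => \1_B w * Num.max (Y w - s) 0.
have mZ : measurable_fun setT Z.
  apply: measurable_funM => //.
  by apply: measurable_maxr => //; apply: measurable_funB.
have Z0 w : 0 <= Z w by rewrite /Z mulr_ge0// le_max lexx orbT.
pose Z' : {RV P >-> R} := mfun_Sub (mem_set mZ).
transitivity ('E_P[Z'])%E.
  rewrite expectation_def integral_mkcond; apply: eq_integral => w _.
  by rewrite patchE /= /Z indicE; case: ifP => _; rewrite ?mul1r ?mul0r.
rewrite (@ge0_expectation_ccdf _ _ _ P Z' Z0).
have ccdfE r : 0 <= r ->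
    ccdf Z' r = ((fine (P B) * (expR (- s) / 2))%:E * (expR (- r))%:E)%E.
  move=> r0; rewrite /ccdf /distribution /pushforward.
  rewrite (_ : Z' @^-1` _ = B `&` [set w | r + s < Y w]).
    rewrite tailY ?addr_ge0// -EFinM; congr EFin.
    by rewrite opprD expRD; ring.
  apply/seteqP; split => w /=; rewrite in_itv/= andbT /Z indicE.
    case: (boolP (w \in B)) => [/set_mem Bw|_]; last by rewrite mul0r ltNge r0.
    by rewrite mul1r lt_max [r < 0]ltNge r0 orbF ltrBrDr.
  by move=> [/mem_set -> rY]; rewrite mul1r lt_max ltrBrDr rY.
under eq_integral.
  move=> x; rewrite inE/= in_itv/= andbT => x0; rewrite ccdfE//; over.
rewrite ge0_integralZl//=; last 2 first.
- by apply/measurable_EFinP/measurable_funTS; exact: measurableT_comp.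
- by rewrite lee_fin mulr_ge0 ?fine_ge0// divr_ge0// expR_ge0.
by rewrite integral_expRN_itvcy oppr0 expR0 mule1.
Qed.
End exponential_tail.

(** * Scores restricted to product events *)

Section adaptive_choice.
Context (R : realType) (n : nat) (d : measure_display) (T : measurableType d).
Context (P : probability T R) (c : 'I_n -> {RV P >-> R}).
Hypothesis hc : iid_with_law (@double_exponential R) c.
Implicit Types (J : {set 'I_n}) (B : set T) (X : {set cube n}) (i : 'I_n).

(** The events that the outcomes of separate tests on the scores in J can
produce. *)
Definition past_event J B := exists2 A : 'I_n -> set R,
  (forall i, measurable (A i)) & B = \bigcap_(i in [set` J]) (c i @^-1` A i).

Lemma past_event_setT : past_event finset.set0 setT.
Proof.
by exists (fun=> setT) => //; apply/seteqP; split.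
Qed.

Lemma measurable_past_event J B : past_event J B -> measurable B.
Proof.
move=> [A mA ->]; apply: fin_bigcap_measurable => [|i _]; first exact: finite_finset.
by rewrite -[_ @^-1` _]setTI; exact: measurable_funP.
Qed.

(** Independence of a fresh score from the past: it is the difference between
the product rules for J and for J with i added. *)
Lemma past_eventI J i B (A : set R) : i \notin J -> measurable A ->
  past_event J B ->
  past_event (i |: J) (B `&` c i @^-1` A) /\
  P (B `&` c i @^-1` A) = (P B * P (c i @^-1` A))%E.
Proof.
move=> iJ mA [A0 mA0 ->].
pose A1 j := if j == i then A else A0 j.
have mA1 j : measurable (A1 j) by rewrite /A1; case: ifP.
have A1J j : j \in J -> A1 j = A0 j.
  by rewrite /A1 => jJ; case: eqP => // ji; rewrite -ji jJ in iJ.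
have E : \bigcap_(j in [set` J]) (c j @^-1` A0 j) `&` c i @^-1` A =
    \bigcap_(j in [set` i |: J]) (c j @^-1` A1 j).
  apply/seteqP; split => w /=.
    move=> [H Hi] j /=; rewrite !finset.inE /A1; case: eqP => [-> //|_ /= jJ].
    exact: H.
  move=> H; split.
    move=> j /= jJ; have := H j; rewrite /= A1J//; apply.
    by rewrite !finset.inE jJ orbT.
  by have := H i; rewrite /= /A1 eqxx; apply; rewrite !finset.inE eqxx.
split; first by exists A1.
rewrite E !(proj1 hc)// big_setU1//= muleC {2}/A1 eqxx; congr (_ * _)%E.
by apply: eq_bigr => j /A1J ->.
Qed.

Lemma past_event_weaken J i B : i \notin J -> past_event J B ->
  past_event (i |: J) B.
Proof.
move=> iJ pB; have [+ _] := past_eventI iJ measurableT pB.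
by rewrite preimage_setT setIT.
Qed.

Lemma past_event_upper_tail J i B r : i \notin J -> past_event J B -> 0 <= r ->
  P (B `&` [set w | r < c i w]) = (fine (P B) * (expR (- r) / 2))%:E.
Proof.
move=> iJ pB r0.
have mA : measurable (`]r, +oo[%classic : set R) by [].
have [_] := past_eventI iJ mA pB.
rewrite (_ : c i @^-1` _ = [set w | r < c i w]); last first.
  by apply/seteqP; split => w /=; rewrite in_itv/= andbT.
move=> ->; rewrite EFinM fineK ?fin_num_measure//; last exact: measurable_past_event pB.
congr (_ * _)%E; rewrite -double_exponential_itvoy// -(proj2 hc i)//.
by congr (P _); apply/seteqP; split => w /=; rewrite in_itv/= andbT.
Qed.

Lemma past_event_lower_tail J i B r : i \notin J -> past_event J B -> 0 <= r ->
  P (B `&` [set w | r < - c i w]) = (fine (P B) * (expR (- r) / 2))%:E.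
Proof.
move=> iJ pB r0.
have mA : measurable (`]-oo, (- r)%R[%classic : set R) by [].
have [_] := past_eventI iJ mA pB.
rewrite (_ : c i @^-1` _ = [set w | r < - c i w]); last first.
  by apply/seteqP; split => w /=; rewrite in_itv/= ltrNr.
move=> ->; rewrite EFinM fineK ?fin_num_measure//; last exact: measurable_past_event pB.
congr (_ * _)%E; rewrite -double_exponential_itvNyo// -(proj2 hc i)//.
by congr (P _); apply/seteqP; split => w /=; rewrite in_itv/= ltrNr.
Qed.

Lemma integrable_coordinate i : P.-integrable setT (EFin \o c i).
Proof.
have iJ : i \notin finset.set0 by rewrite finset.inE.
have up := integral_excess measurableT (measurable_funP (c i))
  (fun r => past_event_upper_tail iJ past_event_setT) (lexx 0).
have mN : measurable_fun setT (fun w => - c i w) by exact: measurable_funN.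
have lo := integral_excess measurableT mN
  (fun r => past_event_lower_tail iJ past_event_setT) (lexx 0).
apply/integrableP; split; first exact/measurable_EFinP.
have -> : (\int[P]_w `|(EFin \o c i) w| =
   \int[P]_w ((Num.max (c i w - 0) 0)%:E + (Num.max (- c i w - 0) 0)%:E))%E.
  apply: eq_integral => w _ /=; rewrite -EFinD !subr0; congr EFin.
  have [?|?] := leP 0 (c i w).
    by rewrite ger0_norm// max_r ?addr0// oppr_le0.
  by rewrite ltr0_norm// max_l ?add0r// oppr_ge0 ltW.
rewrite ge0_integralD//=; last 4 first.
- by move=> w _; rewrite lee_fin le_max lexx orbT.
- by apply/measurable_EFinP; apply: measurable_maxr => //; exact: measurable_funB.
- by move=> w _; rewrite lee_fin le_max lexx orbT.
- by apply/measurable_EFinP; apply: measurable_maxr => //; exact: measurable_funB.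
by rewrite up lo -EFinD ltry.
Qed.

Lemma integrable_coordinate_in i B : measurable B ->
  P.-integrable B (EFin \o c i).
Proof. by move=> mB; apply: integrableS (integrable_coordinate i). Qed.

Lemma Rintegral_excess J i B (s : R) : i \notin J -> past_event J B -> 0 <= s ->
  \int[P]_(w in B) Num.max (c i w - s) 0 = fine (P B) * (expR (- s) / 2) /\
  \int[P]_(w in B) Num.max (- c i w - s) 0 = fine (P B) * (expR (- s) / 2).
Proof.
move=> iJ pB s0; have mB := measurable_past_event pB.
have mN : measurable_fun setT (fun w => - c i w) by exact: measurable_funN.
split; rewrite /Rintegral.
  by rewrite (integral_excess mB _ (fun r => past_event_upper_tail iJ pB)).
by rewrite (integral_excess mB mN (fun r => past_event_lower_tail iJ pB)).
Qed.

Lemma integrable_excess B (Y : T -> R) (s : R) : measurable B ->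
  P.-integrable B (EFin \o Y) ->
  P.-integrable B (EFin \o (fun w => Num.max (Y w - s) 0)).
Proof.
move=> mB iY.
have iYs : P.-integrable B (EFin \o (fun w => Y w - s)).
  exact: (integrableB mB iY (finite_measure_integrable_cst P s mB)).
apply: (le_integrable mB _ _ iYs).
  apply/measurable_EFinP; apply: measurable_maxr => //.
  by apply/measurable_EFinP; exact: (measurable_int P).
move=> w _; rewrite lee_fin /= [leLHS]ger0_norm ?le_max ?lexx ?orbT//.
by rewrite ge_max ler_norm normr_ge0.
Qed.

(** The positive and the negative part of a score have equal integrals over a
past event, by symmetry of the tails. *)
Lemma Rintegral_coordinate J i B : i \notin J -> past_event J B ->
  \int[P]_(w in B) c i w = 0.
Proof.
move=> iJ pB; have mB := measurable_past_event pB.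
have [up lo] := Rintegral_excess iJ pB (lexx 0).
have ic := integrable_coordinate_in i mB.
have icN : P.-integrable B (EFin \o (fun w => - c i w)) := integrableN ic.
transitivity (\int[P]_(w in B)
   (Num.max (c i w - 0) 0 - Num.max (- c i w - 0) 0)).
  apply: eq_Rintegral => w _; rewrite !subr0.
  have [?|?] := leP 0 (c i w).
    by rewrite max_r ?subr0// oppr_le0.
  by rewrite max_l ?oppr_ge0 ?(ltW _)// sub0r opprK.
by rewrite RintegralB ?up ?lo ?subrr//; exact: integrable_excess.
Qed.

(** For t <= 0 the integrand is an excess over -t. For t > 0,
max(c + t, 0) = (c + t) + max(- c - t, 0) reduces to an excess of -c, and the
score itself integrates to 0. *)
Lemma Rintegral_gain J i B (t : R) : i \notin J -> past_event J B ->
  \int[P]_(w in B) Num.max (c i w + t) 0 = fine (P B) * laplace_gain t.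
Proof.
move=> iJ pB; have mB := measurable_past_event pB.
have ic := integrable_coordinate_in i mB.
have icN : P.-integrable B (EFin \o (fun w => - c i w)) := integrableN ic.
rewrite /laplace_gain; have [t0|/ltW t0] := leP t 0.
  have Nt0 : 0 <= - t by rewrite oppr_ge0.
  have [+ _] := Rintegral_excess iJ pB Nt0.
  rewrite ler0_norm// add0r => <-.
  by apply: eq_Rintegral => w _; rewrite opprK.
have [_ lo] := Rintegral_excess iJ pB t0.
have ict : P.-integrable B (EFin \o cst t) by exact: finite_measure_integrable_cst.
transitivity (\int[P]_(w in B) ((c i w + t) + Num.max (- c i w - t) 0)).
  apply: eq_Rintegral => w _.
  rewrite -opprD; have [h|h] := leP (c i w + t) 0.
    by rewrite max_l ?oppr_ge0// subrr.
  by rewrite max_r ?addr0// oppr_le0 ltW.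
rewrite RintegralD//; last 2 first.
- exact: (integrableD mB ic ict).
- exact: integrable_excess.
rewrite RintegralD// (Rintegral_coordinate iJ pB) Rintegral_cst// lo add0r.
by rewrite ger0_norm// mulrDr mulrC.
Qed.

(** * The adaptive choice *)

(** The reward still to be collected once the coordinates in J are decided;
putting zeros there keeps all maxima over subsets of one cube. *)
Definition unrevealed J (w : T) : 'I_n -> R :=
  fun i => if i \in J then 0 else c i w.

Lemma integrable_cube_max J X B : X != finset.set0 -> measurable B ->
  P.-integrable B (EFin \o (fun w => cube_max X (unrevealed J w))).
Proof.
move=> X0 mB.
have isum : P.-integrable B (EFin \o (fun w => \sum_(i < n) `|c i w|)).
  have H := @integrable_sum _ _ _ P B mB _ (index_enum 'I_n) xpredT
     (fun i w => `|c i w|%:E)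
     (fun i _ => integrable_norm (integrable_coordinate_in i mB)).
  by apply: eq_integrable H => // w _ /=; rewrite sumEFin.
apply: (le_integrable mB _ _ isum).
  apply/measurable_EFinP; apply: measurable_funTS; rewrite /cube_max.
  apply: measurableT_comp; first exact: fine_measurable.
  elim: (index_enum _) => [|x s IH].
    by under [X in measurable_fun _ X]eq_fun do rewrite big_nil; exact: measurable_cst.
  under [X in measurable_fun _ X]eq_fun do rewrite big_cons.
  case: (x \in X) => //; apply: measurable_maxe => //.
  apply/measurable_EFinP; apply: measurable_sum => i.
  apply: measurable_funM => //; rewrite /unrevealed; case: (i \in J) => //.
move=> w _ /=; have [x xX ->] := cube_max_attained (unrevealed J w) X0.
rewrite lee_fin [leRHS]ger0_norm ?sumr_ge0// (le_trans (ler_norm_sum _ _ _))//.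
apply: ler_sum => i _; rewrite normrM /unrevealed; case: (i \in J).
  by rewrite normr0 mul0r.
by case: (x i); rewrite ?normr1 ?mulr1// normr0 mulr0.
Qed.


Lemma cube_dot_unrevealed J i (x : cube n) w : i \notin J ->
  cube_dot (unrevealed J w) x =
  c i w * (x i)%:R + cube_dot (unrevealed (i |: J) w) x.
Proof.
move=> iJ; rewrite /cube_dot (bigD1 i)//= [in RHS](bigD1 i)//=.
rewrite /unrevealed (negbTE iJ) !finset.inE eqxx mul0r add0r; congr (_ + _).
by apply: eq_bigr => j ji; rewrite !finset.inE (negbTE ji).
Qed.

Definition slice (b : bool) i X : {set cube n} := [set x in X | x i == b]%SET.

Lemma cube_max_slice_ge J i X b w : i \notin J -> slice b i X != finset.set0 ->
  c i w * b%:R + cube_max (slice b i X) (unrevealed (i |: J) w) <=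
  cube_max X (unrevealed J w).
Proof.
move=> iJ X0.
have [x + ->] := cube_max_attained (unrevealed (i |: J) w) X0.
rewrite finset.inE => /andP[xX /eqP xib].
by rewrite -{1}xib -cube_dot_unrevealed//; exact: cube_max_ge.
Qed.

Lemma sliceC0 b i X : slice b i X = finset.set0 -> slice (~~ b) i X = X.
Proof.
move=> X0; apply/setP => x; rewrite finset.inE.
have /setP/(_ x) := X0; rewrite !finset.inE.
by case: (x \in X) => //=; case: (x i) (b) => [] [].
Qed.

Lemma card_slice i X : #|X| = (#|slice false i X| + #|slice true i X|)%N.
Proof.
rewrite -(cardsID [set x : cube n | ~~ x i]%SET X); congr (_ + _)%N;
  by apply: eq_card => x; rewrite !finset.inE; case: (x i); rewrite ?andbT ?andbF.
Qed.

(** The function L abstracts the two lower bounds to be proved; L J X is a bound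
for sets X whose points agree on the decided coordinates J. *)
Variable L : {set 'I_n} -> {set cube n} -> R.
Hypothesis L_singleton : forall x, L finset.setT (finset.set1 x) <= 0.
Hypothesis L_one_slice : forall J i X b, i \notin J -> X != finset.set0 ->
  slice (~~ b) i X = finset.set0 -> L J X <= L (i |: J) X.
Hypothesis L_two_slices : forall J i X, i \notin J ->
  slice false i X != finset.set0 -> slice true i X != finset.set0 ->
  L J X <= L (i |: J) (slice false i X) +
    laplace_gain (L (i |: J) (slice true i X) - L (i |: J) (slice false i X)).

Let fP0 B : 0 <= fine (P B). Proof. by rewrite fine_ge0. Qed.

(** One threshold test. On the part B1 of B where c_i > - t the maximum is at
least c_i plus the one for the slice x_i = 1, on the rest B0 it is at least the
one for x_i = 0. With t = L1 - L0 the lower bound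
P(B1) L1 + P(B0) L0 equals P(B) L0 + P(B1) t, and the integral of c_i + t over B1
is P(B) times the gain. *)
Lemma two_slices_bound J i X B : i \notin J -> past_event J B ->
  slice false i X != finset.set0 -> slice true i X != finset.set0 ->
  (forall b B', past_event (i |: J) B' ->
    fine (P B') * L (i |: J) (slice b i X) <=
    \int[P]_(w in B') cube_max (slice b i X) (unrevealed (i |: J) w)) ->
  fine (P B) * L J X <= \int[P]_(w in B) cube_max X (unrevealed J w).
Proof.
move=> iJ pB F0 T0 IH; have mB := measurable_past_event pB.
have X0 : X != finset.set0.
  by have /set0Pn[x] := F0; rewrite finset.inE => /andP[xX _]; apply/set0Pn; exists x.
have := L_two_slices iJ F0 T0.
set L0 := L _ (slice false i X); set L1 := L _ (slice true i X).
set t := L1 - L0 => LX.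
pose A1 : set R := `](- t)%R, +oo[%classic.
pose A0 : set R := `]-oo, (- t)%R]%classic.
pose B1 := B `&` c i @^-1` A1; pose B0 := B `&` c i @^-1` A0.
have mA1 : measurable A1 by exact: measurable_itv.
have mA0 : measurable A0 by exact: measurable_itv.
have [pB1 _] := past_eventI iJ mA1 pB.
have [pB0 _] := past_eventI iJ mA0 pB.
have mB1 := measurable_past_event pB1; have mB0 := measurable_past_event pB0.
have BE : B = B1 `|` B0.
  apply/seteqP; split => [w Bw|w [[]//|[]//]].
  by have [h|h] := ltP (- t) (c i w); [left|right]; split => //; rewrite /A1 /A0/= in_itv/= ?h.
have disj : [disjoint B1 & B0].
  apply/disj_setPS => w [[_ +] [_ +]]; rewrite /A1 /A0/= !in_itv/= andbT.
  by move=> h; rewrite leNgt h.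
have split_int (f : T -> R) : P.-integrable B (EFin \o f) ->
    \int[P]_(w in B) f w = \int[P]_(w in B1) f w + \int[P]_(w in B0) f w.
  by move=> fi; rewrite {1}BE Rintegral_setU// -BE.
have PE : fine (P B) = fine (P B1) + fine (P B0).
  by have := split_int _ (finite_measure_integrable_cst P 1 mB); rewrite !Rintegral_cst// !mul1r.
have ic := integrable_coordinate_in i mB1.
have it : P.-integrable B1 (EFin \o cst t) by exact: finite_measure_integrable_cst.
have gainE : fine (P B) * laplace_gain t = \int[P]_(w in B1) c i w + t * fine (P B1).
  rewrite -(Rintegral_gain t iJ pB) split_int; last first.
    have := integrable_excess (- t) mB (integrable_coordinate_in i mB).
    by apply: eq_integrable => // w _ /=; rewrite opprK.
  rewrite [X in _ + X](_ : _ = 0) ?addr0; last first.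
    transitivity (\int[P]_(w in B0) (0 : R)); last by rewrite Rintegral_cst// mul0r.
    apply: eq_Rintegral => w /set_mem[_]; rewrite /A1 /A0/= in_itv/= => h.
    by rewrite max_r//; lra.
  rewrite -Rintegral_cst// -RintegralD//.
  apply: eq_Rintegral => w /set_mem[_]; rewrite /A1 /A0/= in_itv/= andbT => h.
  by rewrite max_l//; lra.
have iM1 := integrable_cube_max (i |: J) T0 mB1.
rewrite split_int; last exact: integrable_cube_max.
have H1 : \int[P]_(w in B1) c i w + fine (P B1) * L1 <=
    \int[P]_(w in B1) cube_max X (unrevealed J w).
  apply: le_trans (_ : \int[P]_(w in B1) (c i w +
      cube_max (slice true i X) (unrevealed (i |: J) w)) <= _).
    by rewrite RintegralD// lerD2l; exact: IH.
  apply: le_Rintegral => //.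
  - exact: (integrableD mB1 ic iM1).
  - exact: integrable_cube_max.
  - by move=> w _; have := @cube_max_slice_ge J i X true w iJ T0; rewrite mulr1.
have H0 : fine (P B0) * L0 <= \int[P]_(w in B0) cube_max X (unrevealed J w).
  apply: le_trans (IH false _ pB0) _.
  apply: le_Rintegral => //; try exact: integrable_cube_max.
  move=> w _; have := @cube_max_slice_ge J i X false w iJ F0.
  by rewrite mulr0 add0r.
apply: le_trans (lerD H1 H0).
apply: le_trans (ler_wpM2l (fP0 B) LX) _.
rewrite mulrDr gainE PE /t; lra.
Qed.

(** Induction on the number of undecided coordinates. When one slice is empty the
coordinate is forced; revealing its score then contributes c_i or 0, both of
integral 0. *)
Lemma adaptive_choice_bound J B X : past_event J B -> X != finset.set0 ->
  (forall x y i, x \in X -> y \in X -> i \in J -> x i = y i) ->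
  fine (P B) * L J X <= \int[P]_(w in B) cube_max X (unrevealed J w).
Proof.
have [m] := ubnP #|~: J|%SET; elim: m J B X => // m IH J B X.
rewrite ltnS => Jm pB X0 agree.
have mB := measurable_past_event pB.
have [/eqP JT|] := boolP (J == finset.setT).
  have /set0Pn[x xX] := X0.
  have XE : X = [set x]%SET.
    apply/setP => y; rewrite finset.inE; apply/idP/eqP => [yX|->//].
    by apply/ffunP => i; apply: agree => //; rewrite JT finset.inE.
  rewrite (_ : \int[P]_(w in B) _ = 0).
    by rewrite mulr_ge0_le0// XE JT.
  transitivity (\int[P]_(w in B) (0 : R)); last by rewrite Rintegral_cst// mul0r.
  apply: eq_Rintegral => w _; have [y _ ->] := cube_max_attained (unrevealed J w) X0.
  by apply: big1 => i _; rewrite /unrevealed JT finset.inE mul0r.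
rewrite -finset.subTset => /subsetPn[i _ iJ].
have IHi b B' : past_event (i |: J) B' -> slice b i X != finset.set0 ->
    fine (P B') * L (i |: J) (slice b i X) <=
    \int[P]_(w in B') cube_max (slice b i X) (unrevealed (i |: J) w).
  move=> pB' S0; apply: IH => //.
    apply: leq_trans Jm; apply: proper_card; apply/properP; split.
      by rewrite finset.setCS finset.subsetUr.
    by exists i; rewrite !finset.inE ?eqxx.
  move=> x y j; rewrite !finset.inE => /andP[xX /eqP xi] /andP[yX /eqP yi].
  by case/orP => [/eqP ->|]; [rewrite xi yi|exact: agree].
have one b : slice (~~ b) i X = finset.set0 ->
    fine (P B) * L J X <= \int[P]_(w in B) cube_max X (unrevealed J w).
  move=> S0; have SX : slice b i X = X by rewrite -[b]negbK; exact: sliceC0.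
  have pB' := past_event_weaken iJ pB.
  have S1 : slice b i X != finset.set0 by rewrite SX.
  have ic := integrable_coordinate_in i mB.
  have icb : P.-integrable B (EFin \o (fun w => c i w * b%:R)).
    by apply: (le_integrable mB _ _ ic) => [|w _]; [apply/measurable_EFinP;
      apply: measurable_funTS; exact: measurable_funM |
      rewrite lee_fin normrM; case: (b); rewrite ?normr1 ?mulr1// normr0 mulr0].
  apply: le_trans (ler_wpM2l (fP0 B) (L_one_slice iJ X0 S0)) _.
  have := IHi b B pB' S1; rewrite SX => /le_trans; apply.
  have iM := integrable_cube_max (i |: J) X0 mB.
  apply: le_trans (_ : \int[P]_(w in B) (c i w * b%:R +
      cube_max X (unrevealed (i |: J) w)) <= _).
    by rewrite RintegralD// RintegralZr// (Rintegral_coordinate iJ pB) mul0r add0r.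
  apply: le_Rintegral => //.
  - exact: (integrableD mB icb iM).
  - exact: integrable_cube_max.
  - by move=> w _; have := @cube_max_slice_ge J i X b w iJ S1; rewrite SX.
have [F0|F0] := eqVneq (slice false i X) finset.set0; first exact: (one true).
have [T0|T0] := eqVneq (slice true i X) finset.set0; first exact: (one false).
apply: (two_slices_bound iJ pB F0 T0) => b B' pB'; apply: IHi => //.
by case: b.
Qed.

End adaptive_choice.

(** * The two lower bounds on Gamma *)

Section gamma_bounds.
Context (R : realType) (n : nat) (d : measure_display) (T : measurableType d).
Context (P : probability T R) (c : 'I_n -> {RV P >-> R}).
Hypothesis hc : iid_with_law (@double_exponential R) c.

Lemma unrevealed_set0 w : unrevealed c finset.set0 w = (fun i => c i w).
Proof. by apply/funext => i; rewrite /unrevealed finset.inE. Qed.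

Lemma GammaE (X : {set cube n}) : X != finset.set0 ->
  Gamma c X = (\int[P]_w cube_max X (unrevealed c finset.set0 w))%:E.
Proof.
move=> X0; rewrite /Gamma unlock /Rintegral fineK.
  by apply: eq_integral => w _; rewrite unrevealed_set0.
exact: integrable_fin_num (integrable_cube_max hc finset.set0 X0 measurableT).
Qed.

Lemma Gamma_ge (L : {set 'I_n} -> {set cube n} -> R) (X : {set cube n}) :
  (forall x, L finset.setT [set x]%SET <= 0) ->
  (forall (J : {set 'I_n}) i (X : {set cube n}) b, i \notin J -> X != finset.set0 ->
    slice (~~ b) i X = finset.set0 -> L J X <= L (i |: J)%SET X) ->
  (forall (J : {set 'I_n}) i (X : {set cube n}), i \notin J ->
    slice false i X != finset.set0 -> slice true i X != finset.set0 ->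
    L J X <= L (i |: J)%SET (slice false i X) +
      laplace_gain (L (i |: J)%SET (slice true i X) -
                    L (i |: J)%SET (slice false i X))) ->
  X != finset.set0 -> ((L finset.set0 X)%:E <= Gamma c X)%E.
Proof.
move=> L1 L2 L3 X0; rewrite GammaE// lee_fin.
have := adaptive_choice_bound hc L1 L2 L3 (past_event_setT c) X0.
rewrite probability_setT mul1r; apply => x y i.
by rewrite finset.inE.
Qed.

Lemma slice_gt0 b i (X : {set cube n}) : slice b i X != finset.set0 ->
  0 < #|slice b i X|%:R :> R.
Proof. by rewrite ltr0n card_gt0. Qed.

(** The bound L(X) = ln|X| / (2 ln 2); its recursive inequality is
[expRD_le_gain] applied to the logarithms of the two slice sizes. *)
Lemma ln_card_le_Gamma (X : {set cube n}) : X != finset.set0 ->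
  ((ln #|X|%:R)%:E <= (2 * ln 2)%:E * Gamma c X)%E.
Proof.
move=> X0.
have a0 : 0 < 2 * ln 2 :> R by rewrite mulr_gt0// ln_gt0// ltr1n.
suff : ((ln #|X|%:R / (2 * ln 2))%:E <= Gamma c X)%E.
  by rewrite GammaE// -EFinM !lee_fin ler_pdivrMr// mulrC.
apply: (@Gamma_ge (fun _ X => ln #|X|%:R / (2 * ln 2))) => //.
  by move=> x; rewrite cards1 ln1 mul0r.
move=> J i Y iJ /slice_gt0 Y0 /slice_gt0 Y1.
rewrite ler_pdivrMr// [leRHS]mulrC -[leRHS]expRK ler_ln ?posrE ?expR_gt0//; last first.
  by rewrite (card_slice i) natrD addr_gt0.
rewrite (card_slice i) natrD; apply: le_trans (expRD_le_gain _ _).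
by rewrite ![2 * ln 2 * (_ / _)]mulrC !divfK ?gt_eqF// !lnK.
Qed.

Definition max_unrevealed_weight (J : {set 'I_n}) (X : {set cube n}) : nat :=
  \max_(x in X) (\sum_(i | i \notin J) x i)%N.

Lemma max_unrevealed_weight_slice (J : {set 'I_n}) i b (X : {set cube n}) :
  i \notin J -> slice b i X != finset.set0 ->
  (max_unrevealed_weight (i |: J) (slice b i X) + b <= max_unrevealed_weight J X)%N.
Proof.
rewrite -card_gt0 /max_unrevealed_weight => iJ S0.
have [x + ->] := eq_bigmax_cond
  (fun x : cube n => (\sum_(j | j \notin i |: J) x j)%N) S0.
rewrite finset.inE => /andP[xX /eqP xi].
apply: leq_trans (leq_bigmax_cond _ xX).
rewrite [leqRHS](bigD1 i)//= xi addnC leq_add2l.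
rewrite (eq_bigl (fun j => (j \notin J) && (j != i)))// => j.
by rewrite !finset.inE negb_or andbC.
Qed.

(** The radius of the Hamming ball is replaced by a quantity that can decrease
along the induction; after exponentiation the recursive inequality reads
(|X_0| + |X_1|) 2^-k <= |X_0| 2^-k0 + (|X_1| 2^-k1) / 2 with k0 <= k and
k1 < k, followed by [expRD_half_le_gain]. *)
Lemma ln_card_le_Gamma_weight (X : {set cube n}) : X != finset.set0 ->
  ((ln #|X|%:R)%:E <=
    Gamma c X + ((max_unrevealed_weight finset.set0 X)%:R * ln 2)%:E)%E.
Proof.
move=> X0.
have ln2 : 0 < ln 2 :> R by rewrite ln_gt0// ltr1n.
suff : ((ln #|X|%:R - (max_unrevealed_weight finset.set0 X)%:R * ln 2)%:E <=
    Gamma c X)%E by rewrite GammaE// -EFinD !lee_fin lerBlDr.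
apply: (@Gamma_ge
  (fun J X => ln #|X|%:R - (max_unrevealed_weight J X)%:R * ln 2)) => //.
- move=> x; rewrite cards1 ln1 sub0r oppr_le0 mulr_ge0// ltW//.
- move=> J i Y b iJ Y0 S0; rewrite lerD2l lerN2 ler_pM2r// ler_nat.
  have SY : slice b i Y = Y by rewrite -[b]negbK; exact: sliceC0.
  have := @max_unrevealed_weight_slice J i b Y iJ.
  rewrite SY => /(_ Y0); apply: leq_trans; exact: leq_addr.
move=> J i Y iJ Y0 Y1.
have := max_unrevealed_weight_slice iJ Y0; have := max_unrevealed_weight_slice iJ Y1.
set k := max_unrevealed_weight J Y.
set k1 := max_unrevealed_weight _ (slice true i Y).
set k0 := max_unrevealed_weight _ (slice false i Y); rewrite addn1 addn0 => k1k k0k.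
move: Y0 Y1 => /slice_gt0 Y0 /slice_gt0 Y1.
rewrite -ler_expR; apply: le_trans (expRD_half_le_gain _ _).
have E (y : R) m : 0 < y -> expR (ln y - m%:R * ln 2) = y / 2 ^+ m.
  by move=> y0; rewrite expRD expRN lnK// mulrC expRM_natl lnK ?posrE// mulrC.
rewrite !E//; last by rewrite (card_slice i) natrD addr_gt0.
rewrite (card_slice i) natrD mulrDl lerD//.
  by rewrite ler_pM2l// lef_pV2 ?posrE ?exprn_gt0// ler_weXn2l// ler1n.
by rewrite -mulrA ler_pM2l// -invfM -exprSr lef_pV2 ?posrE ?exprn_gt0//
  ler_weXn2l// ler1n.
Qed.

End gamma_bounds.

Theorem theorem7p1 (R : realType) (n : nat)
    (d : measure_display) (T : measurableType d) (P : probability T R)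
    (c : 'I_n -> {RV P >-> R})
    (hc : iid_with_law (@double_exponential R) c) :
  (forall X : {set cube n}, X != finset.set0 ->
     ((ln #|X|%:R)%:E <= (2 * ln 2)%:E * Gamma c X)%E)
  /\
  (forall (X : {set cube n}) (k : nat), X != finset.set0 ->
     (forall x, x \in X -> (weight x <= k)%N) ->
     ((ln #|X|%:R)%:E <= Gamma c X + (k%:R * ln 2)%:E)%E).
Proof.
split=> [X|X k X0 Xk]; first exact: ln_card_le_Gamma.
apply: le_trans (ln_card_le_Gamma_weight hc X0) _.
rewrite leeD2l// lee_fin ler_wpM2r// ?ln_ge0 ?ler1n// ler_nat.
apply/bigmax_leqP => x /Xk; rewrite /weight.
by rewrite (eq_bigl xpredT) => // i; rewrite finset.inE.
Qed.
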